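(* Let $0<\alpha<\pi$, $m\in\mathbb{N}$ (so $m\ge1$), $\Gamma_\alpha=\{e^{it}:-\alpha\le t\le\alpha\}$, and $$\mathsf{E}_{m,1}(\alpha)=\{z\in\mathbb{C}:z^m+1\in\Gamma_\alpha\}.$$ Then $\mathsf{E}_{m,1}(\alpha)$ does not satisfy the $S$-property.
   Context: Definition ($S$-property). Let $\mathsf{E}\subset\mathbb{C}$ be compact with logarithmic capacity $\operatorname{Cap}(\mathsf{E})>0$, and suppose $\Omega_{\mathsf{E}}=\overline{\mathbb{C}}\setminus\mathsf{E}$ is connected. Assume there exists a subset $\mathsf{E}_0\subset\mathsf{E}$ with $\operatorname{Cap}(\mathsf{E}_0)=0$ such that $\mathsf{E}\setminus\mathsf{E}_0=\bigcup_{i\in I}\Gamma_i$, where the $\Gamma_i$ are disjoint open analytic Jordan arcs and $I\subset\mathbb{N}$. Then $\mathsf{E}$ satisfies the $S$-property if $$\frac{\partial g_{\Omega_{\mathsf{E}}}}{\partial n_+}(z,\infty)=\frac{\partial g_{\Omega_{\mathsf{E}}}}{\partial n_-}(z,\infty)$$ for all $z\in\mathsf{E}\setminus\mathsf{E}_0$, where $g_{\Omega_{\mathsf{E}}}(\cdot,\infty)$ is the Green's function of $\Omega_{\mathsf{E}}$ with pole at $\infty$ and $n_+$, $n_-$ denote the unit normals from each side of the arcs. *)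

(* Defs.v *)
From HB Require Import structures.
From mathcomp Require Import all_boot all_order all_algebra.
From mathcomp Require Import complex.
From mathcomp Require Import all_classical all_reals all_analysis.

Set Implicit Arguments.
Unset Strict Implicit.
Unset Printing Implicit Defensive.

Import Order.TTheory GRing.Theory Num.Theory.
Import numFieldNormedType.Exports.
Import ComplexField.Normc.

Local Open Scope classical_set_scope.
Local Open Scope ring_scope.

(* R[i] carries its ring structure only; the topology, the norm and the
   differential structure over R[i] are attached to the regular module R[i]^o.
   The modulus as an element of R is [normc]; [`|z|] is R[i]-valued. *)
Notation Cplx R := (R[i]^o)%type.

Definition cmod (R : realType) (z : Cplx R) : R := normc (z : R[i]).

Definition of_real (R : realType) (t : R) : Cplx R := Complex t 0.

Definition iunit (R : realType) : Cplx R := Complex 0 1.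

Definition BorelC (R : realType) := g_sigma_algebraType (@open (Cplx R)).

Definition log_energy (R : realType) (mu : probability (BorelC R) R) : \bar R :=
  (\int[mu]_z \int[mu]_w (- lne (cmod (z - w : Cplx R))%:E))%E.

(* The infimum over the empty family is +oo, and then the capacity is 0. *)
Definition log_cap (R : realType) (E : set (Cplx R)) : \bar R :=
  expeR (- ereal_inf
    [set log_energy mu | mu in [set mu : probability (BorelC R) R |
       exists K : set (Cplx R), [/\ compact K, K `<=` E & mu K = 1%E]]])%E.

Definition on_line (R : realType) (u : Cplx R -> R) (z v : Cplx R) : R -> R :=
  fun t => u (z + of_real t * v).

Definition partial (R : realType) (v : Cplx R) (u : Cplx R -> R) : Cplx R -> R :=
  fun z => derive1 (on_line u z v) 0.

Definition C1_on (R : realType) (U : set (Cplx R)) (u : Cplx R -> R) :=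
  forall v, v = 1 \/ v = iunit R -> forall z, U z ->
    derivable (on_line u z v) 0 1 /\ {for z, continuous (partial v u)}.

Definition harmonic_on (R : realType) (U : set (Cplx R)) (u : Cplx R -> R) :=
  [/\ C1_on U u, C1_on U (partial 1 u), C1_on U (partial (iunit R) u) &
      forall z, U z ->
        partial 1 (partial 1 u) z + partial (iunit R) (partial (iunit R) u) z = 0].

(* g is harmonic on C \ E, bounded away from infinity, equal to log |z| + O(1)
   at infinity, and tends to 0 at every boundary point outside a Borel set of
   capacity zero.  These conditions determine g on C \ E (when Cap E > 0); the
   last clause is the usual extension of g by 0 to E, which gives its
   boundary values on the analytic arcs contained in E. *)
Definition is_green (R : realType) (E : set (Cplx R)) (g : Cplx R -> R) :=
  [/\ harmonic_on (~` E) g,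
      forall r : R, exists M : R, forall z, ~ E z -> cmod z <= r -> `|g z| <= M,
      exists r M : R, forall z, r <= cmod z -> `|g z - ln (cmod z)| <= M,
      exists N : set (BorelC R),
        [/\ measurable N, log_cap (N : set (Cplx R)) = 0%E &
            forall x, (closure (~` E) `&` closure E) x -> ~ N x ->
              g @ within (~` E) (nbhs x) --> (0 : R)] &
      forall z, E z -> g z = 0].

Definition arc_param (R : realType) (phi : Cplx R -> Cplx R) (A : set (Cplx R)) :=
  exists U : set (Cplx R),
    [/\ open U,
        forall t : R, 0 < t < 1 -> U (of_real t),
        forall z, U z -> derivable phi z 1 /\ derive1 phi z != 0,
        {in U &, injective phi} &
        A = [set phi (of_real t) | t in [set t : R | 0 < t < 1]]].

Definition analytic_arc (R : realType) (A : set (Cplx R)) :=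
  exists phi, arc_param phi A.

(* The other unit normal at z is [- n]. *)
Definition unit_normal (R : realType) (A : set (Cplx R)) (z n : Cplx R) :=
  exists phi (t : R), [/\ arc_param phi A, 0 < t < 1, z = phi (of_real t) &
    n = iunit R * (derive1 phi (of_real t) / of_real (cmod (derive1 phi (of_real t))))].

Definition normal_derivative (R : realType) (g : Cplx R -> R) (z n : Cplx R)
    (d : R) :=
  (fun h : R => h^-1 * (g (z + of_real h * n) - g z)) @ 0^'+ --> d.

Definition arc_decomposition (R : realType) (E E0 : set (Cplx R))
    (I : set nat) (Gam : nat -> set (Cplx R)) :=
  [/\ E0 `<=` E, log_cap E0 = 0%E,
      E `\` E0 = \bigcup_(i in I) Gam i,
      trivIset I Gam &
      forall i, I i -> analytic_arc (Gam i)].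

Definition S_property (R : realType) (E : set (Cplx R)) :=
  [/\ compact E, (0 < log_cap E)%E,
      connected (~` ([eta Some] @` E)
        : set (one_point_compactification (Cplx R))) &
      exists (E0 : set (Cplx R)) (I : set nat) (Gam : nat -> set (Cplx R)),
        arc_decomposition E E0 I Gam /\
        forall g, is_green E g ->
        forall i z n, I i -> Gam i z -> unit_normal (Gam i) z n ->
          exists d : R, normal_derivative g z n d /\ normal_derivative g z (- n) d].

Definition circ_arc (R : realType) (alpha : R) : set (Cplx R) :=
  [set (Complex (cos t) (sin t) : Cplx R) | t in [set t : R | - alpha <= t <= alpha]].

Definition Em1 (R : realType) (m : nat) (alpha : R) : set (Cplx R) :=
  [set z | circ_arc alpha (z ^+ m + 1)].

(* Main.v *)
(** With [a = z^m], [w = a + 1] and [k = 2 - 2 cos alpha], put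
    [D = a^2 + k (a + 1) = w^2 - 2 w cos alpha + 1].  The two branches of
    [Phi = a + sqrt D] have product [- k w], and on the arc both have modulus
    [sqrt k]; hence the Green's function is [1/m] times the logarithm of
    [max |a +- sqrt D| / sqrt k].  Near a point of the arc this is a maximum of
    two smooth functions whose sum is [(1/m) ln |w|].  The S-property would force
    the normal derivative of that sum to vanish, but the normals of the arc are
    mapped to nonzero real multiples of [w]. *)
Require Import Defs.
From mathcomp Require Import all_boot all_order all_algebra.
From mathcomp Require Import complex ring lra.
From mathcomp Require Import all_classical all_reals all_analysis.
Set Implicit Arguments.
Unset Strict Implicit.
Unset Printing Implicit Defensive.
Import Order.TTheory GRing.Theory Num.Theory.
Import numFieldNormedType.Exports.
Import ComplexField.Normc.
Local Open Scope classical_set_scope.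
Local Open Scope ring_scope.

(** * Complex differentiation *)

(** [D] factors as [(w - e^(i alpha)) (w - e^(-i alpha))], so it vanishes at the tips of the arc,
    and [k] is the squared distance from [1] to a tip. The branches have equal modulus on the arc
    because there [a^2] and [D] are real multiples of [w] of opposite signs; conversely, off the arc
    [D / a^2] never meets the closed negative axis. The obstacle is the choice of the root.
    Harmonicity needs a branch that is holomorphic off the arc: [a] times the principal root of
    [D / a^2]. The normal derivatives need a branch that is holomorphic across the arc: [a] times
    [i] times the principal root of [- D / a^2]. The candidate is therefore defined by a real
    formula free of branches, and each branch is used only locally. Since [S_property] speaks of
    every function satisfying [is_green], one explicit instance is enough to refute it. The test
    point must avoid [z = 0] and the tips, which leaves out only finitely many points. *)

Section Caratheodory.
Variable K : numFieldType.
Implicit Types (f g : K^o -> K^o) (z l : K^o).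

(* Caratheodory's form of "[f] has derivative [l] at [z]": no quotient, and the
   same calculus serves complex derivatives and real derivatives along lines. *)
Definition cdiff f z l := exists2 s : K^o -> K^o,
  s @ z --> l & \forall w \near z, f w - f z = (w - z) * s w.

Lemma cst_cvg_nbhs (c z : K^o) : (fun=> c) @ z --> c.
Proof. exact: (@cvg_cst _ _ _ (nbhs z)). Qed.
Arguments cst_cvg_nbhs : clear implicits.

Lemma id_cvg_nbhs (z : K^o) : (fun w => w) @ z --> z.
Proof. exact: (@cvg_id _ (nbhs z)). Qed.
Arguments id_cvg_nbhs : clear implicits.

Lemma sub_cvg_nbhs (z : K^o) : (fun w => w - z) @ z --> z - z.
Proof. exact: (cvgB (id_cvg_nbhs z) (cst_cvg_nbhs z z)). Qed.
Arguments sub_cvg_nbhs : clear implicits.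

Lemma cdiff_continuous f z l : cdiff f z l -> f @ z --> f z.
Proof.
move=> [s cs fs]; suff : f @ z --> f z + (z - z) * l by rewrite subrr mul0r addr0.
have e : \forall w \near z, f z + (w - z) * s w = f w.
  by apply: filterS fs => w fw; rewrite -fw subrKC.
apply: cvg_trans (near_eq_cvg e) _.
exact: (cvgD (cst_cvg_nbhs (f z) z) (cvgM (sub_cvg_nbhs z) cs)).
Qed.

Lemma cdiff_cst (c : K^o) z : cdiff (fun=> c) z 0.
Proof.
exists (fun=> 0); first exact: cst_cvg_nbhs.
by near=> w; rewrite subrr mulr0.
Unshelve. all: by end_near. Qed.

Lemma cdiff_id z : cdiff (fun w => w) z 1.
Proof.
exists (fun=> 1); first exact: cst_cvg_nbhs.
by near=> w; rewrite mulr1.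
Unshelve. all: by end_near. Qed.

Lemma cdiffD f g z l l' : cdiff f z l -> cdiff g z l' ->
  cdiff (fun w => f w + g w) z (l + l').
Proof.
move=> [s cs fs] [s' cs' fs'].
exists (fun w => s w + s' w); first exact: (cvgD cs cs').
near=> w; rewrite mulrDr -(near fs w)// -(near fs' w)//.
by rewrite opprD addrACA.
Unshelve. all: by end_near. Qed.

Lemma cdiffM f g z l l' : cdiff f z l -> cdiff g z l' ->
  cdiff (fun w => f w * g w) z (l * g z + f z * l').
Proof.
move=> df dg; have cg := cdiff_continuous dg.
move: df dg => [s cs fs] [s' cs' fs'].
exists (fun w => s w * g w + f z * s' w).
  exact: (cvgD (cvgM cs cg) (cvgM (cst_cvg_nbhs (f z) z) cs')).
near=> w; rewrite mulrDr mulrA -(near fs w)// mulrCA -(near fs' w)//.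
ring.
Unshelve. all: by end_near. Qed.

Lemma cdiffV f z l : f z != 0 -> cdiff f z l ->
  cdiff (fun w => (f w)^-1) z (- l / f z ^+ 2).
Proof.
move=> fz0 df; have cf := cdiff_continuous df.
move: df => [s cs fs].
exists (fun w => - s w / (f w * f z)).
  have fz2 : f z * f z != 0 by rewrite mulf_neq0.
  exact: (cvgM (cvgN cs) (cvgV fz2 (cvgM cf (cst_cvg_nbhs (f z) z)))).
have nz : \forall w \near z, f w != 0 by exact: (cvgr_neq0 _ cf fz0).
near=> w.
have fw0 : f w != 0 by near: w.
have : f w - f z = (w - z) * s w by near: w.
rewrite mulrA mulrN => <-; field.
by rewrite fz0 fw0.
Unshelve. all: by end_near. Qed.

Lemma cdiffX f z l n : cdiff f z l ->
  cdiff (fun w => f w ^+ n) z (n%:R * f z ^+ n.-1 * l).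
Proof.
move=> df; elim: n => [|n IHn].
  by rewrite !mul0r; under eq_fun do rewrite expr0; exact: cdiff_cst.
under eq_fun do rewrite exprS.
suff -> : n.+1%:R * f z ^+ n.+1.-1 * l =
  l * f z ^+ n + f z * (n%:R * f z ^+ n.-1 * l) by exact: cdiffM.
case: n {IHn} => [|n] /=; first by rewrite !expr0; ring.
by rewrite exprS -[n.+2%:R]natr1; ring.
Qed.

(* [(g w - g z) * (g w + g z) = f w - f z], and the second factor tends to [2 * g z]. *)
Lemma cdiff_sqrt f g z l : g @ z --> g z -> g z != 0 ->
  (\forall w \near z, g w ^+ 2 = f w) -> cdiff f z l -> cdiff g z (l / (2 * g z)).
Proof.
move=> cg gz0 gf [s cs fs].
have cgg : (fun w => g w + g z) @ z --> g z + g z.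
  exact: (cvgD cg (cst_cvg_nbhs (g z) z)).
have g20 : g z + g z != 0 by rewrite -mulr2n mulrn_eq0.
exists (fun w => s w / (g w + g z)).
  have -> : l / (2 * g z) = l * (g z + g z)^-1 by rewrite mulr_natl mulr2n.
  exact: (cvgM cs (cvgV g20 cgg)).
have gfz := nbhs_singleton gf.
have nz : \forall w \near z, g w + g z != 0 by exact: (cvgr_neq0 _ cgg g20).
near=> w.
have gw0 : g w + g z != 0 by near: w.
have : f w - f z = (w - z) * s w by near: w.
rewrite mulrA => <-; rewrite -gfz -(near gf w)//; field.
by rewrite gw0.
Unshelve. all: by end_near. Qed.

Lemma derivable_cdiff (f : K^o -> K^o) z : derivable f z 1 -> cdiff f z (derive1 f z).
Proof.
(* The slope function is the difference quotient, completed at [z] by its limit. *)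
move=> df; pose s w := if w == z then derive1 f z else (f w - f z) / (w - z).
have cs : s @ z --> s z.
  apply/(@continuous_withinNshiftx K K^o K^o).
  have -> : s z = derive1 f z by rewrite /s eqxx.
  have e : \forall h \near (0 : K)^', h^-1 *: (f (h *: (1 : K^o) + z) - f z) = (s \o shift z) h.
    near=> h; rewrite /s /= [h *: 1]mulr1 -subr_eq0 addrK ifN; first by rewrite [LHS]mulrC.
    by near: h; exact: nbhs_dnbhs_neq.
  apply: cvg_trans (near_eq_cvg e) _.
  by rewrite derive1E; exact: df.
exists s; first by move: cs; rewrite {2}/s eqxx.
near=> w; rewrite /s; case: eqVneq => [->|wz]; first by rewrite !subrr mul0r.
by field; rewrite subr_eq0.
Unshelve. all: by end_near. Qed.

Lemma near_eq_cdiff f g z l : (\forall w \near z, f w = g w) -> cdiff f z l -> cdiff g z l.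
Proof.
move=> fg [s cs fs]; exists s => //; have fgz := nbhs_singleton fg.
by near=> w; rewrite -fgz -(near fg w)// -(near fs w).
Unshelve. all: by end_near. Qed.

Lemma cdiff_is_derive f z l : cdiff f z l -> is_derive z (1 : K^o) f l.
Proof.
move=> [s cs fs].
suff cl : (fun h : K => h^-1 *: ((f \o shift z) (h *: (1 : K^o)) - f z)) @ (0 : K)^' --> l.
  by split; [apply/cvg_ex; exists l | exact: (cvg_lim (@norm_hausdorff _ _) cl)].
have cz : (fun h : K^o => h + z) @ (0 : K^o) --> 0 + z.
  exact: (cvgD (id_cvg_nbhs (0 : K^o)) (cst_cvg_nbhs z 0)).
rewrite add0r in cz.
have cs0 : (fun h : K^o => s (h + z)) @ (0 : K^o)^' --> l.
  apply: cvg_trans (cvg_comp (fun h : K^o => h + z) s cz cs).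
  by apply: cvg_app; exact: cvg_within.
apply: cvg_trans (near_eq_cvg _) cs0.
have := nbhs_dnbhs (cz _ fs); have := @nbhs_dnbhs_neq K^o 0.
apply: filterS2 => h h0 /= fE.
by rewrite [h *: 1]mulr1 fE addrK [RHS]mulKf.
Qed.

Lemma is_derive_cdiff (f : K^o -> K^o) z l : is_derive z (1 : K^o) f l -> cdiff f z l.
Proof.
by move=> [df <-]; rewrite -derive1E; exact: derivable_cdiff.
Qed.

End Caratheodory.

Arguments cst_cvg_nbhs {K} c z _ _.
Arguments id_cvg_nbhs {K} z _ _.

Section C1Holomorphic.
Variable K : numFieldType.
Implicit Types (f g : K^o -> K^o) (U : set K^o).

(** Continuity of the derivative is built in: the continuous second partials required by
    [harmonic_on] then come from algebraic closure properties, without Cauchy's theorem. *)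
Definition holoC1 U f := exists f' : K^o -> K^o,
  forall z, U z -> cdiff f z (f' z) /\ f' @ z --> f' z.

Lemma holoC1_cst U (c : K^o) : holoC1 U (fun=> c).
Proof.
by exists (fun=> 0) => z _; split; [exact: cdiff_cst | exact: cst_cvg_nbhs].
Qed.

Lemma holoC1_id U : holoC1 U (fun z => z).
Proof.
by exists (fun=> 1) => z _; split; [exact: cdiff_id | exact: cst_cvg_nbhs].
Qed.

Lemma holoC1D U f g : holoC1 U f -> holoC1 U g -> holoC1 U (fun z => f z + g z).
Proof.
move=> [f' df] [g' dg]; exists (fun z => f' z + g' z) => z Uz.
have [[dfz cf] [dgz cg]] := (df z Uz, dg z Uz).
by split; [exact: cdiffD | exact: (cvgD cf cg)].
Qed.

Lemma holoC1M U f g : holoC1 U f -> holoC1 U g -> holoC1 U (fun z => f z * g z).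
Proof.
move=> [f' df] [g' dg]; exists (fun z => f' z * g z + f z * g' z) => z Uz.
have [[dfz cf'] [dgz cg']] := (df z Uz, dg z Uz).
have [cf cg] := (cdiff_continuous dfz, cdiff_continuous dgz).
by split; [exact: cdiffM | exact: (cvgD (cvgM cf' cg) (cvgM cf cg'))].
Qed.

Lemma holoC1X U f n : holoC1 U f -> holoC1 U (fun z => f z ^+ n).
Proof.
move=> df; elim: n => [|n IHn].
  by under eq_fun do rewrite expr0; exact: holoC1_cst.
by under eq_fun do rewrite exprS; exact: holoC1M.
Qed.

Lemma holoC1V U f : (forall z, U z -> f z != 0) -> holoC1 U f ->
  holoC1 U (fun z => (f z)^-1).
Proof.
move=> f0 [f' df]; exists (fun z => - f' z / f z ^+ 2) => z Uz.
have [dfz cf'] := df z Uz; have cf := cdiff_continuous dfz.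
split; first exact: cdiffV (f0 z Uz) dfz.
have f20 : f z * f z != 0 by rewrite mulf_neq0 ?f0.
have cf2 : (fun w => f w ^+ 2) @ z --> f z ^+ 2 by exact: (cvgM cf cf).
exact: (cvgM (cvgN cf') (cvgV f20 cf2)).
Qed.

Lemma holoC1_sqrt U f g : open U -> (forall z, U z -> g z != 0 /\ g z ^+ 2 = f z) ->
  (forall z, U z -> g @ z --> g z) -> holoC1 U f -> holoC1 U g.
Proof.
move=> oU gf cg [f' df]; exists (fun z => f' z / (2 * g z)) => z Uz.
have [[dfz cf'] [gz0 _]] := (df z Uz, gf z Uz).
split.
  apply: cdiff_sqrt dfz => //; first exact: cg.
  have nU : nbhs z U by exact: open_nbhs_nbhs.
  by apply: filterS nU => w /gf[].
have g20 : 2 * g z != 0 by rewrite mulf_neq0 ?pnatr_eq0.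
exact: (cvgM cf' (cvgV g20 (cvgM (cst_cvg_nbhs (2 : K^o) z) (cg z Uz)))).
Qed.

End C1Holomorphic.

Section ComplexPlane.
Variable R : realType.
Implicit Types (z w v l : Cplx R) (t : R).

Lemma cplx_normE z : `|z| = (cmod z)%:C%C.
Proof. by rewrite /cmod; case: z. Qed.

Lemma cmod_ge_Re z : `|complex.Re z| <= cmod z.
Proof. by rewrite -lecR -cplx_normE; exact: normc_ge_Re. Qed.

Lemma cmod_ge_Im z : `|complex.Im z| <= cmod z.
Proof.
have := cmod_ge_Re (z * iunit R).
rewrite /cmod normcM ReiNIm normrN; case: z => x y /=.
by rewrite expr0n /= add0r expr1n sqrtr1 mulr1.
Qed.

Lemma cmod_of_real t : cmod (of_real t) = `|t|.
Proof. by rewrite /cmod /= expr0n /= addr0 sqrtr_sqr. Qed.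

Lemma ReB z w : complex.Re (z - w) = complex.Re z - complex.Re w.
Proof. by case: z w => [a b] [c d]. Qed.

Lemma ImB z w : complex.Im (z - w) = complex.Im z - complex.Im w.
Proof. by case: z w => [a b] [c d]. Qed.

Lemma of_real0 : of_real 0 = 0 :> Cplx R. Proof. by []. Qed.

Section limits.
Context {T : Type} {F : set_system T} {FF : Filter F}.

Lemma cvg_Re (f : T -> Cplx R) l :
  f @ F --> l -> (fun x => complex.Re (f x)) @ F --> complex.Re l.
Proof.
move=> /cvgrPdist_lt fl; apply/cvgrPdist_lt => e e0.
have e0' : 0 < e%:C%C by rewrite ltcR.
apply: filterS (fl _ e0') => x; rewrite cplx_normE ltcR; apply: le_lt_trans.
by have := cmod_ge_Re (l - f x); case: (l) (f x) => [a b] [c d].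
Qed.

Arguments cvg_Re {f l} _.

Lemma cvg_Im (f : T -> Cplx R) l :
  f @ F --> l -> (fun x => complex.Im (f x)) @ F --> complex.Im l.
Proof.
move=> /cvgrPdist_lt fl; apply/cvgrPdist_lt => e e0.
have e0' : 0 < e%:C%C by rewrite ltcR.
apply: filterS (fl _ e0') => x; rewrite cplx_normE ltcR; apply: le_lt_trans.
by have := cmod_ge_Im (l - f x); case: (l) (f x) => [a b] [c d].
Qed.

Arguments cvg_Im {f l} _.

Lemma cvg_complex (f g : T -> R) a b :
  f @ F --> a -> g @ F --> b ->
  (fun x => Complex (f x) (g x) : Cplx R) @ F --> (Complex a b : Cplx R).
Proof.
move=> /cvgrPdist_lt fa /cvgrPdist_lt gb; apply/cvgrPdist_lt => e.
case: e => e i; rewrite ltcE /= => /andP[/eqP -> e0].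
have e20 : 0 < e / 2 by rewrite divr_gt0.
near=> x; rewrite cplx_normE ltcR.
have fx : `|a - f x| < e / 2 by near: x; exact: fa.
have gx : `|b - g x| < e / 2 by near: x; exact: gb.
rewrite [e]splitr; apply: le_lt_trans (ltrD fx gx).
rewrite -[`|a - _|]cmod_of_real.
have -> : `|b - g x| = cmod (Complex 0 (b - g x)).
  by rewrite /cmod /= expr0n /= add0r sqrtr_sqr.
apply: le_trans (le_normcD _ _).
by rewrite /cmod /=; simpc.
Unshelve. all: by end_near. Qed.

Arguments cvg_complex {f g a b} _ _.

Lemma cvg_cmod (f : T -> Cplx R) l : f @ F --> l -> (fun x => cmod (f x)) @ F --> cmod l.
Proof.
move=> fl.
have E z : cmod z = complex.Re `|z| by rewrite cplx_normE.
rewrite E; under eq_fun do rewrite E.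
exact: (cvg_Re (cvg_norm fl)).
Qed.

End limits.

Lemma cvg_line z v : (fun t => z + of_real t * v) @ (0 : R) --> z.
Proof.
have cid : (fun t : R => t) @ (0 : R) --> (0 : R) by exact: cvg_id.
have c0 : (fun t : R => 0 : R) @ (0 : R) --> (0 : R) by exact: cvg_cst.
have cv : (fun t : R => v) @ (0 : R) --> v by exact: cvg_cst.
have cz : (fun t : R => z) @ (0 : R) --> z by exact: cvg_cst.
have -> : nbhs z = nbhs (z + of_real 0 * v) by rewrite of_real0 mul0r addr0.
exact: (cvgD cz (cvgM (cvg_complex cid c0) cv)).
Qed.

Lemma cdiff_Re_line (f : Cplx R -> Cplx R) z v l : cdiff f z l ->
  cdiff (fun t : R => complex.Re (f (z + of_real t * v))) 0 (complex.Re (l * v)).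
Proof.
move=> [s cs fs].
exists (fun t => complex.Re (s (z + of_real t * v) * v)).
  apply: cvg_Re; have cv : (fun t : R => v) @ (0 : R) --> v by exact: cvg_cst.
  exact: (cvgM (cvg_comp (fun t => z + of_real t * v) s (@cvg_line z v) cs) cv).
have near_t : \forall t \near (0 : R), f (z + of_real t * v) - f z =
  (z + of_real t * v - z) * s (z + of_real t * v) by exact: (@cvg_line z v _ fs).
apply: filterS near_t => t.
rewrite of_real0 mul0r addr0 subr0 addrAC subrr add0r => fE.
rewrite -ReB fE mulrAC -mulrA.
by case: (s _ * v) => a b /=; rewrite mul0r subr0.
Qed.

Lemma cdiff_Im_line (f : Cplx R -> Cplx R) z v l : cdiff f z l ->
  cdiff (fun t : R => complex.Im (f (z + of_real t * v))) 0 (complex.Im (l * v)).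
Proof.
move=> [s cs fs].
exists (fun t => complex.Im (s (z + of_real t * v) * v)).
  apply: cvg_Im; have cv : (fun t : R => v) @ (0 : R) --> v by exact: cvg_cst.
  exact: (cvgM (cvg_comp (fun t => z + of_real t * v) s (@cvg_line z v) cs) cv).
have near_t : \forall t \near (0 : R), f (z + of_real t * v) - f z =
  (z + of_real t * v - z) * s (z + of_real t * v) by exact: (@cvg_line z v _ fs).
apply: filterS near_t => t.
rewrite of_real0 mul0r addr0 subr0 addrAC subrr add0r => fE.
rewrite -ImB fE mulrAC -mulrA.
by case: (s _ * v) => a b /=; rewrite mul0r addr0.
Qed.

End ComplexPlane.

(** * Harmonic functions with holomorphic gradient *)

Section Harmonic.
Variable R : realType.
Implicit Types (z w v l : Cplx R) (t : R) (U : set (Cplx R)) (u : Cplx R -> R).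
Implicit Types F f : Cplx R -> Cplx R.

(* [F] is [u_x - i u_y], twice the Wirtinger derivative of [u]. *)
Definition has_gradient U u F := forall z, U z -> forall v,
  is_derive (0 : R) (1 : R) (on_line u z v) (complex.Re (F z * v)).

Lemma has_gradient_partial U u F z v : has_gradient U u F -> U z ->
  partial v u z = complex.Re (F z * v).
Proof. by move=> uF Uz; rewrite /partial derive1E; have [_ ->] := uF z Uz v. Qed.

Lemma has_gradient_Re U F F' c : (forall z, U z -> cdiff F z (F' z)) ->
  has_gradient U (fun z => complex.Re (F z * c)) (fun z => F' z * c).
Proof.
move=> dF z Uz v; apply: cdiff_is_derive.
have := cdiffM (dF z Uz) (cdiff_cst c z); rewrite mulr0 addr0.
exact: cdiff_Re_line.
Qed.

Lemma near_line U z v : open U -> U z -> \forall t \near (0 : R), U (z + of_real t * v).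
Proof.
move=> oU Uz; have nU : nbhs z U by exact: open_nbhs_nbhs.
exact: (@cvg_line _ z v _ nU).
Qed.

Lemma near_eq_gradient U u u' F : open U -> (forall z, U z -> u z = u' z) ->
  has_gradient U u F -> has_gradient U u' F.
Proof.
move=> oU uu' uF z Uz v; apply: near_eq_is_derive (uF z Uz v).
by apply: filterS (near_line v oU Uz) => t Ut; rewrite /on_line uu'.
Qed.

Lemma C1_of_gradient U u F : open U -> has_gradient U u F ->
  (forall z, U z -> F @ z --> F z) -> C1_on U u.
Proof.
move=> oU uF cF v _ z Uz; split; first by case: (uF z Uz v).
rewrite /prop_for /continuous_at (has_gradient_partial v uF Uz).
have nU : nbhs z U by exact: open_nbhs_nbhs.
have cv : (fun w : Cplx R => complex.Re (F w * v)) @ z --> complex.Re (F z * v).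
  have cFv : (fun w : Cplx R => F w * v) @ z --> F z * v.
    exact: (cvgM (cF z Uz) (cst_cvg_nbhs v z)).
  exact: (cvg_Re cFv).
apply: cvg_trans (near_eq_cvg _) cv.
by apply: filterS nU => w Uw; rewrite (has_gradient_partial v uF Uw).
Qed.

(** The partial along [v] is the real part of [F v], so the second partial is the real part of
    [F' v^2], and [1^2 + i^2 = 0]. *)
Lemma harmonic_of_gradient U u F F' : open U -> has_gradient U u F ->
  (forall z, U z -> cdiff F z (F' z)) -> (forall z, U z -> F' @ z --> F' z) ->
  harmonic_on U u.
Proof.
move=> oU uF dF cF'.
have grad v : has_gradient U (partial v u) (fun z => F' z * v).
  apply: near_eq_gradient oU _ (has_gradient_Re v dF) => z Uz.
  by rewrite (has_gradient_partial v uF).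
have cF'v v z : U z -> (fun w => F' w * v) @ z --> F' z * v.
  by move=> Uz; exact: (cvgM (cF' z Uz) (cst_cvg_nbhs v z)).
split.
- by apply: C1_of_gradient oU uF _ => z /dF /cdiff_continuous.
- exact: C1_of_gradient oU (grad 1) (cF'v 1).
- exact: C1_of_gradient oU (grad (iunit R)) (cF'v (iunit R)).
move=> z Uz; rewrite (has_gradient_partial _ (grad _) Uz) (has_gradient_partial _ (grad _) Uz).
by case: (F' z) => a b /=; ring.
Qed.

Definition normsq z : R := complex.Re z ^+ 2 + complex.Im z ^+ 2.

Lemma normsq_cmod z : normsq z = cmod z ^+ 2.
Proof. by case: z => a b; rewrite /cmod /= sqr_sqrtr// addr_ge0 ?sqr_ge0. Qed.

Lemma cmod_normsq z : cmod z = Num.sqrt (normsq z).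
Proof. by case: z. Qed.

Lemma normsqM z w : normsq (z * w) = normsq z * normsq w.
Proof. by rewrite !normsq_cmod /cmod normcM exprMn. Qed.

Lemma normsq_ge0 z : 0 <= normsq z.
Proof. by rewrite addr_ge0 ?sqr_ge0. Qed.

Lemma normsq_gt0 z : (0 < normsq z) = (z != 0).
Proof.
rewrite lt_def normsq_ge0 andbT; congr negb.
by case: z => a b; rewrite /normsq eq_complex /= paddr_eq0 ?sqr_ge0// !sqrf_eq0.
Qed.

Lemma cdiff_normsq_line f z v l : cdiff f z l ->
  cdiff (fun t : R => normsq (f (z + of_real t * v))) 0
        (2 * complex.Re ((f z)^*%C * (l * v))).
Proof.
move=> df; have dX := cdiffX 2 (cdiff_Re_line v df); have dY := cdiffX 2 (cdiff_Im_line v df).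
have := cdiffD dX dY; rewrite of_real0 mul0r addr0 /=.
set a := (X in cdiff _ _ X -> _); set b := (X in _ -> cdiff _ _ X).
suff -> : a = b by [].
by rewrite /a /b; case: (f z) (l * v) => [x y] [x' y'] /=; ring.
Qed.

(** [F] is the logarithmic derivative of [f]; working with [ln |f|^2] avoids any branch of the
    complex logarithm. *)
Lemma gradient_ln_normsq U f F (c : R) :
  (forall z, U z -> f z != 0 /\ cdiff f z (f z * F z)) ->
  has_gradient U (fun z => c * ln (normsq (f z))) (fun z => of_real (2 * c) * F z).
Proof.
move=> df z Uz v; have [fz0 dfz] := df z Uz.
have f2 : 0 < normsq (f z) by rewrite normsq_gt0.
have dn := cdiff_is_derive (cdiff_normsq_line v dfz).
have dl : is_derive (normsq (f (z + of_real 0 * v))) 1 (@ln R) (normsq (f z))^-1.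
  by rewrite of_real0 mul0r addr0; exact: is_derive1_ln.
have := is_deriveZ c (@is_derive1_comp R (@ln R) (fun t => normsq (f (z + of_real t * v))) 0 _ _ dl dn).
set a := (X in is_derive _ _ _ X -> _); set b := (X in _ -> is_derive _ _ _ X).
suff -> : a = b by [].
rewrite /a /b -[c *: _]/(c * _).
have -> : (f z)^*%C * (f z * F z * v) = of_real (normsq (f z)) * (F z * v).
  rewrite /normsq; case: (f z) (F z) => [x y] [x' y']; case: (v) => p q; simpc.
  by apply/eqP; rewrite eq_complex /=; apply/andP; split; apply/eqP; ring.
have n0 := lt0r_neq0 f2.
rewrite -mulrA; case: (F z * v) => x y /=; rewrite !mul0r !subr0.
by field.
Qed.

End Harmonic.

(** * A continuous square root off the closed negative axis *)

Section PrincipalSqrt.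
Variable R : realType.
Implicit Types q : Cplx R.

(* The plane cut along [[-oo, 0]]. *)
Definition slit q := 0 < cmod q + complex.Re q.

(* The principal branch on the slit plane; on the cut the division by zero makes
   the imaginary part [0]. *)
Definition psqrt q : Cplx R :=
  Complex (Num.sqrt ((cmod q + complex.Re q) / 2))
          (complex.Im q / (2 * Num.sqrt ((cmod q + complex.Re q) / 2))).

Lemma psqrt_gt0 q : slit q -> 0 < complex.Re (psqrt q).
Proof. by move=> q0; rewrite sqrtr_gt0 divr_gt0. Qed.

Lemma sqr_psqrt q : slit q -> psqrt q ^+ 2 = q.
Proof.
move=> sq; have := psqrt_gt0 sq; rewrite /psqrt /=; set r := Num.sqrt _ => r0.
have r2 : r ^+ 2 = (cmod q + complex.Re q) / 2 by rewrite sqr_sqrtr ?divr_ge0 ?ltW.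
have := normsq_cmod q; move: sq r2; rewrite /slit /normsq.
case: (q) (cmod _) => x y c /= c0 r2 cE.
rewrite expr2; apply/eqP; rewrite eq_complex /=; apply/andP; split; apply/eqP; last first.
  by field; exact: lt0r_neq0.
have [rn cxn] : r != 0 /\ c + x != 0 by rewrite !lt0r_neq0.
have yE : y ^+ 2 = (c - x) * (c + x) by lra.
have -> : y / (2 * r) * (y / (2 * r)) = y ^+ 2 / (4 * r ^+ 2) by field.
by rewrite -expr2 r2 yE; field.
Qed.

Lemma psqrt_neq0 q : slit q -> psqrt q != 0.
Proof.
by move=> /psqrt_gt0; apply: contraTneq => ->; rewrite ltxx.
Qed.

Lemma psqrt_cvg q : slit q -> psqrt @ q --> psqrt q.
Proof.
move=> sq; have := psqrt_gt0 sq; rewrite /psqrt /= => r0.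
have cid := id_cvg_nbhs q.
have c1 : (fun q => Num.sqrt ((cmod q + complex.Re q) / 2)) @ q -->
    Num.sqrt ((cmod q + complex.Re q) / 2).
  apply: continuous_comp; last exact: sqrt_continuous.
  have c2 : (fun=> 2^-1 : R) @ q --> (2^-1 : R) by exact: (@cvg_cst _ _ _ (nbhs q)).
  exact: (cvgM (cvgD (cvg_cmod cid) (cvg_Re cid)) c2).
have c2 : (fun=> 2 : R) @ q --> (2 : R) by exact: (@cvg_cst _ _ _ (nbhs q)).
have r20 : 2 * Num.sqrt ((cmod q + complex.Re q) / 2) != 0 by rewrite mulf_neq0 ?lt0r_neq0.
exact: (cvg_complex c1 (cvgM (cvg_Im cid) (cvgV r20 (cvgM c2 c1)))).
Qed.

End PrincipalSqrt.

(** * The Green's function *)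

Section ArcAlgebra.
Variables (R : realType) (k : R).
Hypotheses (k0 : 0 < k) (k4 : k < 4).
Implicit Types a rho : Cplx R.

Lemma cmodM (z w : Cplx R) : cmod (z * w) = cmod z * cmod w.
Proof. exact: normcM. Qed.

Lemma cmod_ge0 (z : Cplx R) : 0 <= cmod z.
Proof. by rewrite cmod_normsq sqrtr_ge0. Qed.

Lemma cmodD (z w : Cplx R) : cmod (z + w) <= cmod z + cmod w.
Proof. exact: le_normcD. Qed.

Lemma cmodX (z : Cplx R) n : cmod (z ^+ n) = cmod z ^+ n.
Proof.
elim: n => [|n IHn]; first by rewrite /cmod !expr0 normc1.
by rewrite !exprS cmodM IHn.
Qed.

(** For [k = 2 - 2 cos alpha] the bound [1 - k / 2] is [cos alpha]; in this form the angle
    disappears from the algebra. *)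
Definition on_arc a := normsq (a + 1) = 1 /\ 1 - k / 2 <= complex.Re (a + 1).

Definition disc a : Cplx R := a ^+ 2 + of_real k * (a + 1).

(* The real part of [disc a] times the conjugate of [a ^+ 2]. *)
Definition disc_dot a : R := complex.Re (disc a) * complex.Re (a ^+ 2) +
  complex.Im (disc a) * complex.Im (a ^+ 2).

(* The larger of [|a + rho a|^2] and [|a - rho a|^2], where [rho a] is a square
   root of [disc a]; written without choosing a branch of the root. *)
Definition maxnormsq a : R := normsq a + cmod (disc a) +
  Num.sqrt (2 * (normsq a * cmod (disc a) + disc_dot a)).

(** If [|w| = 1] and [x] is the real part of [a], then [a^2 = 2 x w] and [D = (2 x + k) w], with
    [|a|^2 = - 2 x] and [2 x + k >= 0]. Hence [|D| = 2 x + k], and [D] and [a^2] point in opposite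
    directions. *)
Lemma on_arc_disc a : on_arc a ->
  normsq a + cmod (disc a) = k /\ normsq a * cmod (disc a) + disc_dot a = 0.
Proof.
case: a => x y [n1 xk].
have {}n1 : (x + 1) ^+ 2 + y ^+ 2 = 1 by move: n1; rewrite /normsq /= addr0.
have {}xk : 1 - k / 2 <= x + 1 := xk.
have y2 : y ^+ 2 = - 2 * x - x ^+ 2 by lra.
have sk : 0 <= 2 * x + k by lra.
have Re_disc : complex.Re (disc (Complex x y)) = (x + 1) * (2 * x + k).
  rewrite /disc expr2 /=; ring: y2.
have Im_disc : complex.Im (disc (Complex x y)) = y * (2 * x + k).
  by rewrite /disc expr2 /=; ring.
have -> : cmod (disc (Complex x y)) = 2 * x + k.
  rewrite cmod_normsq /normsq Re_disc Im_disc !exprMn -mulrDl.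
  have -> : (x + 1) ^+ 2 + y ^+ 2 = 1 by lra.
  by rewrite mul1r sqrtr_sqr ger0_norm.
rewrite /disc_dot Re_disc Im_disc expr2 /normsq /=; split; first by lra.
ring: y2.
Qed.

(** The quantities [|a|^2 (1 + |rho|^2)] and [2 |a|^2 Re rho] are the half sum and half difference
    of [|a + a rho|^2] and [|a - a rho|^2]. The last identity is the product of these two,
    [|a^2 - D|^2]. *)
Lemma sqrt_disc_dot a rho : rho ^+ 2 * a ^+ 2 = disc a ->
  [/\ normsq a + cmod (disc a) = normsq a * (1 + normsq rho),
      2 * (normsq a * cmod (disc a) + disc_dot a) = (2 * normsq a * complex.Re rho) ^+ 2 &
      (normsq a * (1 + normsq rho)) ^+ 2 - (2 * normsq a * complex.Re rho) ^+ 2 =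
        k ^+ 2 * normsq (a + 1)].
Proof.
move=> rhoE.
have cE : cmod (disc a) = normsq rho * normsq a.
  by rewrite -rhoE cmodM !cmodX -!normsq_cmod.
split.
- by rewrite cE; ring.
- rewrite cE /disc_dot -rhoE /normsq; case: (a) (rho) => [x y] [p q].
  rewrite !expr2 /=; ring.
have -> : k ^+ 2 * normsq (a + 1) = normsq (disc a - a ^+ 2).
  by rewrite addrAC subrr add0r normsqM /normsq /= expr0n /= addr0.
rewrite -rhoE /normsq; case: (a) (rho) => [x y] [p q].
rewrite !expr2 /=; ring.
Qed.

Lemma maxnormsq_sqrt a rho : rho ^+ 2 * a ^+ 2 = disc a ->
  maxnormsq a = normsq a * (1 + normsq rho) + `|2 * normsq a * complex.Re rho|.
Proof.
by move=> /sqrt_disc_dot[E1 E2 _]; rewrite /maxnormsq E1 E2 sqrtr_sqr.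
Qed.

Lemma maxnormsq_Phi a rho : rho ^+ 2 * a ^+ 2 = disc a -> 0 <= complex.Re rho ->
  maxnormsq a = normsq (a + a * rho).
Proof.
move=> /maxnormsq_sqrt -> rho0; rewrite ger0_norm; last first.
  by rewrite !mulr_ge0 ?normsq_ge0.
have -> : a + a * rho = a * (1 + rho) by rewrite mulrDr mulr1.
rewrite normsqM /normsq.
by case: (a) (rho) => [x y] [p q] /=; ring.
Qed.

(* If [disc a = - r a^2] with [r >= 0], then [a] solves the real quadratic
   [(1 + r) a^2 + k a + k = 0], whose discriminant is negative; the product and
   the sum of its conjugate roots put [a + 1] on the arc. *)
Lemma slit_off_arc a : ~ on_arc a -> a != 0 /\ slit (disc a / a ^+ 2).
Proof.
move=> na; have a0 : a != 0.
  apply/eqP => a0; apply: na; rewrite /on_arc a0 add0r; split; last by rewrite /= lerBlDr lerDl divr_ge0 ?ltW.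
  by rewrite /normsq /= expr0n /= addr0 expr1n.
split=> //; rewrite /slit ltNge; apply/negP => sle; apply: na.
have : disc a = (disc a / a ^+ 2) * a ^+ 2 by rewrite mulfVK ?expf_neq0.
have := normsq_cmod (disc a / a ^+ 2); have := cmod_ge0 (disc a / a ^+ 2).
move: sle; rewrite /normsq; case: (disc a / _) (cmod _) => p q c /= cp c0 cE dE.
have p0 : p <= 0 by lra.
have q0 : q = 0 by apply/eqP; rewrite -sqrf_eq0 eq_le sqr_ge0 andbT; nra.
move: dE; rewrite q0 {q0 cE}.
case: (a) a0 => x y a0; rewrite /disc !expr2 => /eqP.
rewrite eq_complex /= => /andP[/eqP E1 /eqP E2].
have y0 : y != 0.
  apply: contra_neq a0 => y0; exfalso; move: E1 E2; rewrite y0.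
  set s := 1 - p => E1 _.
  have s1 : 1 <= s by rewrite /s; lra.
  have : (2 * s * x + k) ^+ 2 + 4 * s * k - k ^+ 2 = 0.
    have : s * x ^+ 2 + k * x + k = 0 by rewrite /s; lra.
    move=> E; transitivity (4 * s * (s * x ^+ 2 + k * x + k)); first by ring.
    by rewrite E mulr0.
  have := sqr_ge0 (2 * s * x + k); have : 0 < k * (4 - k) by rewrite mulr_gt0// subr_gt0.
  have : 0 <= (s - 1) * k by apply: mulr_ge0; [rewrite subr_ge0 | exact: ltW].
  lra.
have xE : 2 * (1 - p) * x + k = 0.
  by apply: (mulIf y0); rewrite mul0r; lra.
have yE : y ^+ 2 = - x ^+ 2 - 2 * x.
  have p1 : 1 - p != 0 by lra.
  apply: (mulfI p1); have : k = - 2 * (1 - p) * x by lra.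
  move=> kE; move: E1; rewrite kE => E1; lra.
rewrite /on_arc /normsq /= addr0 yE; split; first by ring.
nra.
Qed.

End ArcAlgebra.

(** * From angles to algebraic conditions *)

Section Em1Arc.
Variables (R : realType) (m : nat) (alpha : R).
Hypotheses (h0 : 0 < alpha) (hpi : alpha < pi).

Lemma circ_arcP (w : Cplx R) :
  circ_arc alpha w <-> normsq w = 1 /\ cos alpha <= complex.Re w.
Proof.
have a0pi : alpha \in `[0, pi] by rewrite in_itv /= !ltW.
split=> [[t /= /andP[ta at_] <-]|].
  split; first by rewrite /normsq /= cos2Dsin2.
  have t_alpha : `|t| <= alpha by rewrite ler_norml ta.
  rewrite /= -[cos t]cos_norm leNgt ltr_cos -?leNgt// in_itv /= normr_ge0 /=.
  exact: le_trans t_alpha (ltW hpi).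
case: w => x y []; rewrite /normsq /= => n1 cx.
have x1 : -1 <= x <= 1 by rewrite -ler_norml -sqrtr_sqr -[leRHS]sqrtr1 ler_wsqrtr//; nra.
have ax : acos x <= alpha.
  rewrite leNgt -ltr_cos ?in_itv/= ?acos_ge0 ?acos_lepi// -?leNgt.
  by rewrite acosK ?in_itv.
have sx : sin (acos x) = `|y|.
  by rewrite sin_acos// -sqrtr_sqr; congr Num.sqrt; lra.
have a0 := acos_ge0 x1.
have [y0|y0] := leP 0 y.
  exists (acos x) => /=; first by rewrite ax andbT (le_trans _ a0)// oppr_le0 ltW.
  by rewrite sx acosK ?in_itv// ger0_norm.
exists (- acos x) => /=; first by rewrite lerN2 ax /= (le_trans _ (ltW h0))// oppr_le0.
by rewrite sinN cosN sx acosK ?in_itv// ltr0_norm// opprK.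
Qed.

Lemma Em1P (z : Cplx R) : Em1 m alpha z <-> on_arc (2 - 2 * cos alpha) (z ^+ m).
Proof.
rewrite /Em1 /= circ_arcP /on_arc.
by have -> : 1 - (2 - 2 * cos alpha) / 2 = cos alpha by field.
Qed.

Lemma cos_gap : 0 < 2 - 2 * cos alpha < 4.
Proof.
have : cos alpha < cos 0 by rewrite ltr_cos ?in_itv/= ?lexx ?pi_ge0 ?ltW.
have : cos pi < cos alpha by rewrite ltr_cos ?in_itv/= ?lexx ?pi_ge0 ?ltW.
by rewrite cos0 cospi => *; apply/andP; split; lra.
Qed.

End Em1Arc.

Lemma log_cap0 (R : realType) : log_cap (set0 : set (Cplx R)) = 0%E.
Proof.
rewrite /log_cap; set S := (X in ereal_inf X).
suff -> : S = set0 by rewrite ereal_inf0.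
rewrite -subset0 => x [mu [K [_ K0 muK]] _] /=.
have {}K0 : K = set0 by rewrite -subset0.
by move: muK; rewrite K0 measure0 => /eqP; rewrite eq_sym onee_eq0.
Qed.

Section Green.
Variables (R : realType) (m : nat) (k : R).
Hypotheses (m0 : (0 < m)%N) (k0 : 0 < k).
Implicit Types (a z : Cplx R).

(** The factor [2] accounts for squared moduli. *)
Definition green z : R := (2 * m%:R)^-1 * (ln (maxnormsq k (z ^+ m)) - ln k).

Lemma maxnormsq_ge a : normsq a + cmod (disc k a) <= maxnormsq k a.
Proof. by rewrite lerDl sqrtr_ge0. Qed.

(** Cauchy-Schwarz gives [disc_dot <= |a|^2 |D|], and then [4 u v <= (u + v)^2] bounds the root. *)
Lemma maxnormsq_le a : maxnormsq k a <= 2 * (normsq a + cmod (disc k a)).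
Proof.
rewrite mulr_natl mulr2n lerD2l.
have A0 : 0 <= normsq a + cmod (disc k a) by rewrite addr_ge0 ?normsq_ge0 ?cmod_ge0.
rewrite -[leRHS]ger0_norm// -sqrtr_sqr ler_wsqrtr//.
have c0 : 0 <= normsq a * cmod (disc k a) by rewrite mulr_ge0 ?normsq_ge0 ?cmod_ge0.
have : disc_dot k a <= normsq a * cmod (disc k a).
  apply: le_trans (ler_norm _) _.
  rewrite -[leRHS]ger0_norm// -ler_sqr ?nnegrE// !real_normK ?num_real//.
  rewrite exprMn -normsq_cmod /disc_dot.
  have -> : normsq a ^+ 2 = normsq (a ^+ 2) by rewrite !normsq_cmod cmodX.
  rewrite /normsq; set p := complex.Re _; set q := complex.Im _.
  set x := complex.Re _; set y := complex.Im _.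
  have := sqr_ge0 (p * y - q * x); nra.
have := sqr_ge0 (normsq a - cmod (disc k a)); nra.
Qed.

(** Either [|a| >= 1/2], or [a + 1] has real part at least [1/2] and
    [k |a + 1| = |D - a^2| <= |D| + |a|^2]. The uniform positive bound keeps the logarithm bounded
    below and continuous. *)
Lemma maxnormsq_lb a : Num.min (1 / 4) (k / 2) <= maxnormsq k a.
Proof.
apply: le_trans (maxnormsq_ge a).
have n0 := normsq_ge0 a; have c0 := cmod_ge0 (disc k a).
have [a4|a4] := leP (1 / 4) (normsq a).
  by rewrite ge_min; apply/orP; left; lra.
rewrite ge_min; apply/orP; right.
have x2 : `|complex.Re a| <= 1 / 2.
  rewrite -ler_sqr ?nnegrE// real_normK ?num_real//.
  by move: a4; rewrite /normsq; have := sqr_ge0 (complex.Im a); lra.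
have : k * cmod (a + 1) <= normsq a + cmod (disc k a).
  have -> : k * cmod (a + 1) = cmod (disc k a - a ^+ 2).
    by rewrite addrAC subrr add0r cmodM cmod_of_real gtr0_norm.
  apply: le_trans (cmodD _ _) _.
  by rewrite [cmod (- _)]normcN -/(cmod _) cmodX -normsq_cmod addrC.
apply: le_trans; rewrite ler_pM2l//.
apply: le_trans (cmod_ge_Re _); apply: le_trans (ler_norm _).
move: x2; rewrite ler_norml; case: (a) => x y /=; lra.
Qed.

Lemma maxnormsq_gt0 a : 0 < maxnormsq k a.
Proof.
by apply: lt_le_trans (maxnormsq_lb a); rewrite lt_min !divr_gt0.
Qed.

Lemma maxnormsq_ub a r : cmod a <= r ->
  maxnormsq k a <= 2 * (r ^+ 2 + (r ^+ 2 + k * (r + 1))).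
Proof.
move=> ar; apply: le_trans (maxnormsq_le a) _.
rewrite ler_pM2l//; have a0 := cmod_ge0 a.
have ar2 : cmod a ^+ 2 <= r ^+ 2 by rewrite ler_sqr ?nnegrE ?(le_trans a0).
apply: lerD; first by rewrite normsq_cmod.
apply: le_trans (cmodD _ _) _; apply: lerD; first by rewrite cmodX.
rewrite cmodM cmod_of_real gtr0_norm// ler_pM2l//.
apply: le_trans (cmodD _ _) _; apply: lerD => //.
by rewrite /cmod normc1.
Qed.

Lemma green_on_arc z : on_arc k (z ^+ m) -> green z = 0.
Proof.
move=> /on_arc_disc[E1 E2]; rewrite /green /maxnormsq E1 E2.
by rewrite mulr0 sqrtr0 addr0 subrr mulr0.
Qed.

Lemma green_bounded (r : R) : exists M : R, forall z, cmod z <= r -> `|green z| <= M.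
Proof.
pose s := `|r| ^+ m; pose B := 2 * (s ^+ 2 + (s ^+ 2 + k * (s + 1))).
pose d := Num.min (1 / 4) (k / 2).
exists ((2 * m%:R)^-1 * (`|ln B| + `|ln d| + `|ln k|)) => z zr.
have d0 : 0 < d by rewrite lt_min !divr_gt0.
have dM : d <= maxnormsq k (z ^+ m) := maxnormsq_lb _.
have MB : maxnormsq k (z ^+ m) <= B.
  apply: maxnormsq_ub; rewrite cmodX lerXn2r ?nnegrE ?cmod_ge0//.
  exact: le_trans zr (ler_norm _).
have M0 := maxnormsq_gt0 (z ^+ m).
rewrite /green normrM ger0_norm ?invr_ge0 ?mulr_ge0//.
rewrite ler_wpM2l ?invr_ge0 ?mulr_ge0//.
apply: le_trans (ler_normB _ _) _; rewrite lerD2r.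
have h1 : ln d <= ln (maxnormsq k (z ^+ m)) by rewrite ler_ln ?posrE.
have h2 : ln (maxnormsq k (z ^+ m)) <= ln B by rewrite ler_ln ?posrE// (lt_le_trans M0).
have := ler_norm (ln B); have := ler_norm (- ln d); rewrite normrN => h3 h4.
have := normr_ge0 (ln d); have := normr_ge0 (ln B) => h5 h6.
by rewrite ler_norml; apply/andP; split; lra.
Qed.

Lemma green_at_infinity : exists M : R, forall z, 1 <= cmod z ->
  `|green z - ln (cmod z)| <= M.
Proof.
exists ((2 * m%:R)^-1 * (ln (4 + 4 * k) + `|ln k|)) => z z1.
set a := z ^+ m; have a1 : 1 <= cmod a by rewrite cmodX exprn_ege1.
have m20 : 2 * m%:R != 0 :> R by rewrite mulf_neq0 ?pnatr_eq0 -?lt0n.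
have -> : ln (cmod z) = (2 * m%:R)^-1 * ln (normsq a).
  rewrite normsq_cmod cmodX -exprM lnXn; last exact: lt_le_trans z1.
  by rewrite -[_ *+ (m * 2)]mulr_natl natrM mulrA [m%:R * 2]mulrC mulVf// mul1r.
rewrite /green -mulrBr normrM ger0_norm ?invr_ge0 ?mulr_ge0//.
rewrite ler_wpM2l ?invr_ge0 ?mulr_ge0//.
rewrite addrAC; apply: le_trans (ler_normB _ _) _; rewrite lerD2r.
have na : 0 < normsq a by rewrite normsq_cmod exprn_gt0// (lt_le_trans ltr01).
have M0 := maxnormsq_gt0 a.
have h1 : ln (normsq a) <= ln (maxnormsq k a).
  by rewrite ler_ln ?posrE//; apply: le_trans (maxnormsq_ge _); rewrite lerDl cmod_ge0.
have k40 : 0 < 4 + 4 * k by rewrite addr_gt0 ?mulr_gt0.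
have h2 : ln (maxnormsq k a) <= ln (4 + 4 * k) + ln (normsq a).
  rewrite -lnM ?posrE// ler_ln ?posrE ?mulr_gt0//.
  apply: le_trans (maxnormsq_ub (lexx _)) _; rewrite normsq_cmod.
  (* The constant [4 + 4 k] works because [|a| + 1 <= 2 |a|^2] for [|a| >= 1], which is this
     factorization. *)
  have : 0 <= k * ((2 * cmod a + 1) * (cmod a - 1)).
    by rewrite mulr_ge0 ?(ltW k0)// mulr_ge0 ?subr_ge0// addr_ge0 ?mulr_ge0 ?cmod_ge0.
  lra.
rewrite ger0_norm; lra.
Qed.

End Green.

(** * Continuity on the plane and harmonicity off the arc *)

Section GreenIsGreen.
Variables (R : realType) (m : nat) (k : R).
Hypotheses (k0 : 0 < k) (k4 : k < 4).
Implicit Types (z : Cplx R) (U : set (Cplx R)).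

Lemma normsq_cvg (f : Cplx R -> Cplx R) z : f @ z --> f z ->
  (fun w => normsq (f w)) @ z --> normsq (f z).
Proof.
move=> cf; pose proof (cvg_Re cf) as cX; pose proof (cvg_Im cf) as cY.
rewrite /normsq expr2 [X in _ + X]expr2; under eq_fun do rewrite expr2 [X in _ + X]expr2.
exact: (cvgD (cvgM cX cX) (cvgM cY cY)).
Qed.

Lemma holoC1_disc U : holoC1 U (fun z => disc k (z ^+ m)).
Proof.
have hm : holoC1 U (fun z => z ^+ m) by apply: holoC1X; exact: holoC1_id.
apply: holoC1D; first exact: holoC1X.
apply: holoC1M; first exact: holoC1_cst.
by apply: holoC1D => //; exact: holoC1_cst.
Qed.

Lemma holoC1_cvg U (f : Cplx R -> Cplx R) z : holoC1 U f -> U z -> f @ z --> f z.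
Proof. by move=> [f' df] Uz; have [dfz _] := df z Uz; exact: cdiff_continuous dfz. Qed.

Lemma green_continuous z : green m k @ z --> green m k z.
Proof.
have ca : (fun z : Cplx R => z ^+ m) @ z --> z ^+ m.
  by apply: (@holoC1_cvg setT) => //; apply: holoC1X; exact: holoC1_id.
have ca2 : (fun z : Cplx R => (z ^+ m) ^+ 2) @ z --> (z ^+ m) ^+ 2 by exact: (cvgM ca ca).
have cd : (fun z => disc k (z ^+ m)) @ z --> disc k (z ^+ m).
  by apply: (@holoC1_cvg setT) => //; exact: holoC1_disc.
have cn := @normsq_cvg (fun z => z ^+ m) z ca.
have cst (c : R) : (fun=> c) @ z --> c by exact: (@cvg_cst _ _ _ (nbhs z)).
have cdot : (fun z => disc_dot k (z ^+ m)) @ z --> disc_dot k (z ^+ m).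
  exact: (cvgD (cvgM (cvg_Re cd) (cvg_Re ca2)) (cvgM (cvg_Im cd) (cvg_Im ca2))).
pose proof (cvgM (cst 2) (cvgD (cvgM cn (cvg_cmod cd)) cdot)) as crad.
pose proof (cvg_comp _ (@Num.sqrt R) crad (@sqrt_continuous R _)) as csqrt.
have cM : (fun z => maxnormsq k (z ^+ m)) @ z --> maxnormsq k (z ^+ m).
  exact: (cvgD (cvgD cn (cvg_cmod cd)) csqrt).
pose proof (cvg_comp _ (@ln R) cM (continuous_ln (maxnormsq_gt0 k0 (z ^+ m)))) as cln.
exact: (cvgM (cst (2 * m%:R)^-1) (cvgB cln (cst (ln k)))).
Qed.

(** The root [h] of [D] below has [h / a] of positive real part, so [a + h] is always the branch of
    larger modulus, it never vanishes, and [green] is a constant plus a multiple of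
    [ln |a + h|^2]. *)
Lemma green_harmonic U : open U -> (forall z, U z -> ~ on_arc k (z ^+ m)) ->
  harmonic_on U (green m k).
Proof.
move=> oU Uk; pose q z := disc k (z ^+ m) / (z ^+ m) ^+ 2.
have slitU z : U z -> z ^+ m != 0 /\ slit (q z) by move=> /Uk/slit_off_arc; apply.
pose h z := z ^+ m * psqrt (q z).
have hm : holoC1 U (fun z => z ^+ m) by apply: holoC1X; exact: holoC1_id.
have hE z : U z -> h z != 0 /\ h z ^+ 2 = disc k (z ^+ m).
  move=> /slitU[a0 sq]; rewrite mulf_neq0 ?psqrt_neq0// exprMn sqr_psqrt//.
  by rewrite mulrC mulfVK// expf_neq0.
have cq z : U z -> q @ z --> q z.
  move=> Uz; apply: (@holoC1_cvg U) => //; apply: holoC1M; first exact: holoC1_disc.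
  by apply: holoC1V; [move=> w /slitU[? _]; rewrite expf_neq0 | exact: holoC1X].
have ch z : U z -> h @ z --> h z.
  move=> Uz; have [_ sq] := slitU z Uz.
  exact: (cvgM (holoC1_cvg hm Uz) (cvg_comp q (@psqrt R) (cq z Uz) (psqrt_cvg sq))).
have hh : holoC1 U h by exact: holoC1_sqrt hE ch (holoC1_disc U).
have Phi0 z : U z -> z ^+ m + h z != 0.
  move=> /slitU[a0 sq]; have -> : z ^+ m + h z = z ^+ m * (1 + psqrt (q z)).
    by rewrite mulrDr mulr1.
  rewrite mulf_neq0//; apply: contraTneq (psqrt_gt0 sq) => /eqP.
  by rewrite addrC addr_eq0 => /eqP -> /=; rewrite oppr_gt0 ltr10.
pose da z : Cplx R := m%:R * z ^+ m.-1.
(* The logarithmic derivative of [a + h], from [h' = (2 a + k) a' / (2 h)]. *)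
pose F z : Cplx R := da z * (2 * h z + 2 * z ^+ m + of_real k) / (2 * h z * (z ^+ m + h z)).
have dPhi z : U z -> cdiff (fun z => z ^+ m + h z) z ((z ^+ m + h z) * F z).
  move=> Uz; have [h0 h2] := hE z Uz; have := cdiffX m (cdiff_id z).
  rewrite mulr1 -/(da z) => dm.
  have ddisc : cdiff (fun z => disc k (z ^+ m)) z ((2 * z ^+ m + of_real k) * da z).
    have := cdiffD (cdiffX 2 dm) (cdiffM (cdiff_cst (of_real k) z)
      (cdiffD dm (cdiff_cst 1 z))).
    set l := (X in cdiff _ _ X -> _); suff -> : l = (2 * z ^+ m + of_real k) * da z by [].
    by rewrite /l /=; ring.
  have nU : nbhs z U by exact: open_nbhs_nbhs.
  have h2U : \forall w \near z, h w ^+ 2 = disc k (w ^+ m).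
    by apply: filterS nU => w /hE[].
  have := cdiffD dm (cdiff_sqrt (ch z Uz) h0 h2U ddisc).
  set l := (X in cdiff _ _ X -> _); suff -> : l = (z ^+ m + h z) * F z by [].
  by rewrite /l /F; field; rewrite h0 Phi0.
have [F' dF] : holoC1 U F.
  apply: holoC1M; first apply: holoC1M.
  - apply: (@holoC1M _ U (fun=> m%:R) (fun z => z ^+ m.-1)); first exact: holoC1_cst.
    by apply: holoC1X; exact: holoC1_id.
  - apply: holoC1D; last exact: holoC1_cst.
    by apply: holoC1D; apply: holoC1M => //; exact: holoC1_cst.
  apply: holoC1V => [z Uz|].
    have [h0 _] := hE z Uz.
    by apply: mulf_neq0 (Phi0 z Uz); apply: mulf_neq0 h0; rewrite pnatr_eq0.
  apply: holoC1M; last exact: holoC1D.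
  by apply: holoC1M => //; exact: holoC1_cst.
pose c : R := (2 * m%:R)^-1.
have gPhi : has_gradient U (fun z => c * ln (normsq (z ^+ m + h z)))
    (fun z => of_real (2 * c) * F z).
  by apply: gradient_ln_normsq => z Uz; split; [exact: Phi0 | exact: dPhi].
have gG : has_gradient U (green m k) (fun z => of_real (2 * c) * F z).
  apply: (@near_eq_gradient _ _ (fun z => c * ln (normsq (z ^+ m + h z)) - c * ln k)) => //.
    move=> z Uz; have [a0 sq] := slitU z Uz.
    rewrite /green mulrBr (@maxnormsq_Phi _ _ _ (psqrt (q z)))//; last exact/ltW/psqrt_gt0.
    by rewrite sqr_psqrt// mulfVK// expf_neq0.
  move=> z Uz v; have := is_deriveB (gPhi z Uz v) (is_derive_cst (c * ln k) (0 : R) (1 : R)).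
  by rewrite subr0.
have hF : holoC1 U (fun z => of_real (2 * c) * F z).
  by apply: holoC1M; [exact: holoC1_cst | exists F'].
have [F2 dF2] := hF.
apply: (@harmonic_of_gradient _ _ _ _ F2 oU gG) => z Uz; have [dFz cFz] := dF2 z Uz.
- exact: dFz.
- exact: cFz.
Qed.

End GreenIsGreen.

Lemma is_green_green (R : realType) (m : nat) (alpha : R) : (0 < m)%N ->
  0 < alpha -> alpha < pi -> closed (Em1 m alpha) ->
  is_green (Em1 m alpha) (green m (2 - 2 * cos alpha)).
Proof.
move=> m0 h0 hpi cE; have /andP[k0 k4] := cos_gap h0 hpi.
split.
- apply: green_harmonic => //; first exact: closed_openC.
  by move=> z nE /(Em1P m h0 hpi).
- move=> r; have [M gM] := green_bounded m k0 r.
  by exists M => z _; exact: gM.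
- by have [M gM] := green_at_infinity m0 k0; exists 1, M.
(* No exceptional points: [green] is continuous on the whole plane and vanishes on the set. *)
- exists set0; split; [exact: measurable0 | exact: log_cap0 |].
  move=> x [_]; rewrite -(closure_id _).1// => Ex _.
  have <- : green m (2 - 2 * cos alpha) x = 0 by apply: green_on_arc; exact/Em1P.
  have gc := @green_continuous R m _ k0 x; apply: cvg_within_filter; exact: gc.
- by move=> z /(Em1P m h0 hpi); exact: green_on_arc.
Qed.

(** * The normal derivatives on the arc *)

Section Jump.
Variable R : realType.

(** Writing [s h = h * Ss h] with [Ss] tending to [s'], one has [|s h| = h |Ss h|] for [h > 0], so
    the corner of [|s|] has right derivative [|s'|]. *)
Lemma ln_right_quotient (A s : R -> R) (k A' s' : R) : 0 < k ->
  cdiff A 0 A' -> cdiff s 0 s' -> A 0 = k -> s 0 = 0 ->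
  (fun h => h^-1 * (ln (A h + `|s h|) - ln k)) @ 0^'+ --> (A' + `|s'|) / k.
Proof.
move=> k0 dA ds A0 s0.
have cM : (fun h => A h + `|s h|) @ (0 : R) --> k.
  have -> : nbhs k = nbhs (A 0 + `|s 0|) by rewrite A0 s0 normr0 addr0.
  exact: (cvgD (cdiff_continuous dA) (cvg_norm (cdiff_continuous ds))).
have [L cL lnE] := is_derive_cdiff (is_derive1_ln k0).
have [SA cSA AE] := dA; have [Ss cSs sE] := ds.
have cLM : (fun h => L (A h + `|s h|)) @ (0 : R) --> k^-1.
  exact: (cvg_comp (fun h => A h + `|s h|) L cM cL).
have lnM : \forall h \near (0 : R), ln (A h + `|s h|) - ln k =
    (A h + `|s h| - k) * L (A h + `|s h|) by exact: (cM _ lnE).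
have cQ : (fun h => (SA h + `|Ss h|) * L (A h + `|s h|)) @ 0^'+ --> (A' + `|s'|) / k.
  apply: cvg_within_filter.
  exact: (cvgM (cvgD cSA (cvg_norm cSs)) cLM).
apply: cvg_trans (near_eq_cvg _) cQ.
near=> h.
have h0 : 0 < h by near: h; exact: nbhs_right_gt.
have -> : ln (A h + `|s h|) - ln k = (A h + `|s h| - k) * L (A h + `|s h|).
  by near: h; exact: (cvg_within _ lnM).
have Ah : A h - A 0 = (h - 0) * SA h by near: h; exact: (cvg_within _ AE).
have sh : s h - s 0 = (h - 0) * Ss h by near: h; exact: (cvg_within _ sE).
have -> : A h + `|s h| - k = h * (SA h + `|Ss h|).
  rewrite s0 !subr0 in sh; rewrite A0 subr0 in Ah.
  by rewrite addrAC Ah sh normrM gtr0_norm// mulrDr.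
by rewrite -mulrA mulKf ?lt0r_neq0.
Unshelve. all: by end_near. Qed.

Variables (m : nat) (k : R).
Hypothesis k0 : 0 < k.
Implicit Types (z n : Cplx R).

(* Near [z] the function [maxnormsq] is [A + |s|] with [A], [s] smooth, [s z = 0],
   and [A^2 - s^2 = k^2 |w|^2].  Replacing [n] by [- n] keeps the [|s'|] term but
   changes the sign of [A' = k c]. *)
Lemma green_normal_derivative z : on_arc k (z ^+ m) -> z ^+ m != 0 ->
  disc k (z ^+ m) != 0 -> exists L : Cplx R, forall n (c : R),
    m%:R * z ^+ m.-1 * n = of_real c * (z ^+ m + 1) ->
    normal_derivative (green m k) z n
      ((2 * m%:R)^-1 * ((k * c + `|complex.Re (L * n)|) / k)).
Proof.
move=> az a0 d0; have [w1 _] := az; have [A0 W0] := on_arc_disc az.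
pose q w := disc k (w ^+ m) / (w ^+ m) ^+ 2.
have nN : 0 < normsq (z ^+ m) by rewrite normsq_gt0.
(* On the arc [q] is a negative real, so the principal root is available for [- q] near [z], and
   multiplying it by [i] gives a root of [q] that continues across the arc. *)
have Req : 0 < complex.Re (- q z).
  have : disc_dot k (z ^+ m) = complex.Re (q z) * normsq ((z ^+ m) ^+ 2).
    have qE : disc k (z ^+ m) = q z * (z ^+ m) ^+ 2 by rewrite mulfVK// expf_neq0.
    rewrite /disc_dot qE /normsq; case: (q z) ((z ^+ m) ^+ 2) => [x y] [x' y'] /=; ring.
  have : 0 < normsq (z ^+ m) * cmod (disc k (z ^+ m)).
    by rewrite mulr_gt0// cmod_normsq sqrtr_gt0 normsq_gt0.
  have : 0 < normsq ((z ^+ m) ^+ 2) by rewrite normsq_gt0 expf_neq0.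
  case: (q z) => x y /=; move: W0; set D := disc_dot _ _; set u := _ * cmod _.
  set v := normsq (_ ^+ 2); nra.
have sq0 : slit (- q z) by rewrite /slit ltr_wpDl ?cmod_ge0.
have dm := cdiffX m (cdiff_id z).
have ddisc : exists l, cdiff (fun w => disc k (w ^+ m)) z l.
  by have [f' df] := @holoC1_disc R m k setT; exists (f' z); case: (df z I).
have [lq dq] : exists l, cdiff (fun w => - q w) z l.
  have [l dl] := ddisc; have a2 : (z ^+ m) ^+ 2 != 0 by rewrite expf_neq0.
  have -> : (fun w => - q w) = (fun w => -1 * q w) by apply/funext => w; rewrite mulN1r.
  have dm2 := cdiffX 2 dm.
  have dV := @cdiffV _ (fun w : Cplx R => (w ^+ m) ^+ 2) z _ a2 dm2.
  have dqz := cdiffM dl dV.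
  have dNq := cdiffM (cdiff_cst (-1) z) dqz.
  eexists.
  exact dNq.
have cq := cdiff_continuous dq.
have slit_near : \forall w \near z, slit (- q w).
  pose proof (cvgD (cvg_cmod cq) (cvg_Re cq)) as cs.
  exact: (cvgr_gt _ cs _ sq0).
have a_near : \forall w \near z, w ^+ m != 0 by exact: (cvgr_neq0 _ (cdiff_continuous dm) a0).
pose rho w := iunit R * psqrt (- q w).
have rhoE : \forall w \near z, rho w ^+ 2 * (w ^+ m) ^+ 2 = disc k (w ^+ m).
  near=> w; have sw : slit (- q w) by near: w.
  have aw : w ^+ m != 0 by near: w.
  rewrite exprMn sqr_psqrt// (_ : iunit R ^+ 2 = -1); last exact: sqr_i.
  by rewrite mulrN mulN1r opprK mulfVK// expf_neq0.
have [lr drho] : exists l, cdiff rho z l.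
  have sqE : \forall w \near z, psqrt (- q w) ^+ 2 = - q w.
    by apply: filterS slit_near => w /sqr_psqrt.
  have cpsq : (fun w => psqrt (- q w)) @ z --> psqrt (- q z).
    exact: (cvg_comp (fun w => - q w) (@psqrt R) cq (psqrt_cvg sq0)).
  eexists; exact: (cdiffM (cdiff_cst (iunit R) z) (cdiff_sqrt cpsq (psqrt_neq0 sq0) sqE dq)).
(* The derivative of [s] along [n] is [2 |a|^2] times the real part of [lr n], the other product
   term vanishing with the real part of [rho z]. The witness is thus the same for [n] and [- n]. *)
exists (of_real (2 * normsq (z ^+ m)) * lr) => n c nc.
pose p t : Cplx R := z + of_real t * n.
have p0 : p 0 = z by rewrite /p of_real0 mul0r addr0.
pose N t := normsq (p t ^+ m).
pose A t := N t * (1 + normsq (rho (p t))).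
pose s t := 2 * N t * complex.Re (rho (p t)).
have rhoE0 := nbhs_singleton rhoE.
have [EA Es EAs] := sqrt_disc_dot rhoE0.
have A0k : A 0 = k by rewrite /A /N p0 -EA.
have s00 : s 0 = 0.
  by apply/eqP; rewrite -sqrf_eq0 /s /N p0 -Es W0 mulr0.
have X0 : complex.Re (rho z) = 0.
  apply/eqP; move/eqP: s00; rewrite /s /N p0 mulf_eq0 mulf_eq0 pnatr_eq0/=.
  by rewrite (negbTE (lt0r_neq0 nN)).
have dN := cdiff_normsq_line n dm.
have dX := cdiff_Re_line n drho.
have [lA dA] : exists l, cdiff A 0 l.
  eexists; exact: (cdiffM dN (cdiffD (cdiff_cst 1 0) (cdiff_normsq_line n drho))).
have ds : cdiff s 0 (complex.Re (of_real (2 * normsq (z ^+ m)) * lr * n)).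
  have := cdiffM (cdiffM (cdiff_cst 2 0) dN) dX.
  set l := (X in cdiff _ _ X -> _); set l' := (X in _ -> cdiff _ _ X).
  suff -> : l = l' by [].
  rewrite /l /l' [z + of_real 0 * n]p0 X0 mulr0 add0r -[of_real _ * lr * n]mulrA.
  by case: (lr * n) => x y /=; rewrite mul0r subr0.
have rhoE_line : \forall t \near (0 : R), rho (p t) ^+ 2 * (p t ^+ m) ^+ 2 = disc k (p t ^+ m).
  exact: (@cvg_line R z n _ rhoE).
(* Differentiating [A^2 - s^2 = k^2 |w|^2] at [0], where [A = k], [s = 0] and [|w| = 1], gives
   [2 k lA = 2 k^2 c]. *)
have lAE : lA = k * c.
  have dw : cdiff (fun w => w ^+ m + 1) z (m%:R * z ^+ m.-1).
    by have := cdiffD dm (cdiff_cst 1 z); rewrite mulr1 addr0.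
  have d1 := cdiffM (cdiff_cst (k ^+ 2) 0) (cdiff_normsq_line n dw).
  have d2 := cdiffD (cdiffX 2 dA) (cdiffM (cdiff_cst (-1) 0) (cdiffX 2 ds)).
  have e12 : \forall t \near (0 : R), A t ^+ 2 + -1 * s t ^+ 2 =
      k ^+ 2 * normsq (p t ^+ m + 1).
    apply: filterS rhoE_line => t /sqrt_disc_dot[_ _ <-].
    by rewrite mulN1r.
  have [_ D1] := cdiff_is_derive d1.
  have [_ D2] := cdiff_is_derive (near_eq_cdiff e12 d2).
  move: D2; rewrite D1 A0k s00 nc [z + of_real 0 * n]p0 => E.
  apply: (mulfI (lt0r_neq0 k0)).
  suff E2 : complex.Re ((z ^+ m + 1)^*%C * (of_real c * (z ^+ m + 1))) = c.
    by move: E; rewrite E2 => E; clear -E; lra.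
  by move: w1; rewrite /normsq; case: (z ^+ m + 1) => x y /= xy; rewrite -[RHS]mulr1 -xy; ring.
rewrite -lAE /normal_derivative.
have gz : green m k z = 0 by exact: green_on_arc.
have cC : (fun=> (2 * m%:R)^-1 : R) @ (0 : R)^'+ --> ((2 * m%:R)^-1 : R) by exact: cvg_cst.
have rhoE_right : \forall t \near (0 : R)^'+,
    rho (p t) ^+ 2 * (p t ^+ m) ^+ 2 = disc k (p t ^+ m).
  exact: (cvg_within _ rhoE_line).
apply: cvg_trans (near_eq_cvg _) (cvgM cC (ln_right_quotient k0 dA ds A0k s00)).
apply: filterS rhoE_right => t /maxnormsq_sqrt tE.
by rewrite gz subr0 /green -/(p t) tE [RHS]mulrCA.
Unshelve. all: by end_near. Qed.

End Jump.

(** * Choice of the test point and the contradiction *)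

(** The points to avoid become roots of one polynomial. The second factor is nonzero because its
    coefficient in degree [2 m] is [1]. *)
Lemma disc_poly_neq0 (R : realType) (m : nat) (k : R) : (0 < m)%N ->
  exists2 p : {poly R[i]}, p != 0 &
    forall z : Cplx R, p.[z] = z ^+ m * disc k (z ^+ m).
Proof.
move=> m0; exists ('X^m * ('X^m ^+ 2 + (of_real k)%:P * ('X^m + 1))).
  rewrite mulf_neq0 ?expf_neq0 ?polyX_eq0//.
  apply/eqP => /(congr1 (fun p : {poly R[i]} => p`_(m * 2))).
  rewrite coefD -exprM coefXn eqxx coefCM coefD coefXn coef1 coef0.
  rewrite -[X in _ == X]muln1 eqn_pmul2l//= muln_eq0 -[m == 0%N]negbK -lt0n m0 /=.
  by rewrite addr0 mulr0 addr0 => /eqP; rewrite oner_eq0.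
by move=> z; rewrite /disc !hornerE.
Qed.

Lemma exists_nonroot (R : realType) (p : {poly R[i]}) (f : R -> Cplx R) : p != 0 ->
  {in [set t : R | 0 < t < 1] &, injective f} -> exists2 t : R, 0 < t < 1 & p.[f t] != 0.
Proof.
move=> p0 finj; apply: contrapT => nex.
(* Starting at [1/2] keeps the points inside the open interval; [size p] distinct roots are already
   one too many. *)
pose u (j : nat) : R := j.+2%:R^-1.
have u01 j : 0 < u j < 1 by rewrite invr_gt0 ltr0n /= invf_lt1 ?ltr0n// ltr1n.
have uinj : injective u by move=> i j /invr_inj /eqP; rewrite eqr_nat => /eqP[].
have rts : all (root p) [seq f (u j) | j <- iota 0 (size p)].
  apply/allP => _ /mapP[j _ ->]; apply/negPn/negP => pj.
  by apply: nex; exists (u j).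
have us : uniq [seq f (u j) | j <- iota 0 (size p)].
  rewrite map_inj_in_uniq ?iota_uniq// => i j _ _ fij.
  by apply: uinj; apply: finj fij; rewrite inE /=.
by have := max_poly_roots p0 rts us; rewrite size_map size_iota ltnn.
Qed.

Theorem proposition2p3 (R : realType) (m : nat) (alpha : R)
    (hm : (0 < m)%N) (h0 : 0 < alpha) (hpi : alpha < pi) :
  ~ S_property (Em1 m alpha).
Proof.
move=> [cptE capE _ [E0 [I [Gam [[sE0 capE0 EE0 _ arcs] S]]]]].
have /andP[k0 k4] := cos_gap h0 hpi; set k := 2 - 2 * cos alpha in k0 k4.
have clE : closed (Em1 m alpha).
  by apply: compact_closed cptE; exact: norm_hausdorff.
(* At least one arc exists: otherwise the set would equal [E0], whose capacity is zero. *)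
have /set0P[x] : Em1 m alpha `\` E0 != set0.
  apply/eqP => E00; move: capE; suff -> : Em1 m alpha = E0 by rewrite capE0 ltxx.
  by apply/seteqP; split => //; rewrite -setD_eq0.
rewrite EE0 => -[i Ii _].
have [phi [U [oU Ut dphi phi_inj GamE]]] := arcs i Ii.
have arcphi : arc_param phi (Gam i) by exists U.
have [p p0 pE] := disc_poly_neq0 k hm.
have [t t01 pt0] : exists2 t : R, 0 < t < 1 & p.[phi (of_real t)] != 0.
  apply: exists_nonroot p0 _ => t t'; rewrite !inE /= => t01 t'01 /phi_inj.
  by rewrite !inE => /(_ (Ut _ t01) (Ut _ t'01)) [].
set z := phi (of_real t); rewrite -/z pE mulf_eq0 negb_or in pt0.
have /andP[a0 d0] := pt0.
have phiE s : 0 < s < 1 -> on_arc k (phi (of_real s) ^+ m).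
  move=> s01; have [+ _] : (Em1 m alpha `\` E0) (phi (of_real s)).
    by rewrite EE0; exists i => //; rewrite GamE; exists s.
  by move=> /(Em1P m h0 hpi).
have [dphit dphi0] := dphi _ (Ut t t01).
have Gz : Gam i z by rewrite GamE; exists t.
set phi' := derive1 phi (of_real t) in dphi0.
have dz : cdiff phi (of_real t) phi' := derivable_cdiff dphit.
have [L HL] := green_normal_derivative k0 (phiE t t01) a0 d0.
have z0 : z != 0 by apply: contraNneq a0 => ->; rewrite expr0n -[m == 0%N]negbK -lt0n hm.
set D := m%:R * z ^+ m.-1 * phi'.
have D0 : D != 0.
  by rewrite mulf_neq0// mulf_neq0 ?expf_neq0// pnatr_eq0 -lt0n.
set w := z ^+ m + 1.
have w1 : normsq w = 1 by case: (phiE t t01).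
(* [D] is the velocity of [w] along the arc, and [|w|^2] is constantly [1] there, so the velocity is
   orthogonal to [w]. *)
have ReD : complex.Re (w^*%C * D) = 0.
  have dg : cdiff (fun v => phi v ^+ m + 1) (of_real t) D.
    by have := cdiffD (cdiffX m dz) (cdiff_cst 1 (of_real t)); rewrite addr0.
  have [_ d1] := cdiff_is_derive (cdiff_normsq_line 1 dg).
  have near1 : \forall s \near (0 : R), 1 = normsq (phi (of_real t + of_real s * 1) ^+ m + 1).
    have /andP[t0 t1] := t01.
    have ts : (fun s : R => t + s) @ (0 : R) --> t + 0.
      exact: (cvgD (cst_cvg_nbhs (t : R^o) (0 : R^o)) (id_cvg_nbhs (0 : R^o))).
    rewrite addr0 in ts.
    near=> s; have ts01 : 0 < t + s < 1.
      by apply/andP; split; near: s; [exact: (cvgr_gt _ ts) | exact: (cvgr_lt _ ts)].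
    have [+ _] := phiE (t + s) ts01.
    by rewrite mulr1 /of_real /=; simpc.
  have [_ d2] := cdiff_is_derive (near_eq_cdiff near1 (cdiff_cst (1 : R) (0 : R))).
  move: d1; rewrite d2 mulr1 => /esym/eqP; rewrite mulf_eq0 pnatr_eq0 /=.
  by move=> /eqP.
set nrm := cmod phi'; set n := iunit R * (phi' / of_real nrm).
have nrm0 : 0 < nrm by rewrite /nrm cmod_normsq sqrtr_gt0 normsq_gt0.
have un : unit_normal (Gam i) z n by exists phi, t.
(* By orthogonality [D = i y w] with [y] real; the normal multiplies by [i] and divides by [nrm],
   giving [- y / nrm] times [w]. *)
set c := - complex.Im (w^*%C * D) / nrm.
have nc : m%:R * z ^+ m.-1 * n = of_real c * w.
  have De : D = w * (w^*%C * D).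
    rewrite mulrA (_ : w * w^*%C = of_real (normsq w)); first by rewrite w1 mul1r.
    rewrite /normsq; case: (w) => x' y'; apply/eqP; rewrite eq_complex /=.
    by apply/andP; split; apply/eqP; ring.
  transitivity (iunit R * D / of_real nrm); first by rewrite /n /D; ring.
  rewrite De mulrCA -mulrA mulrC; congr (_ * _).
  have -> : (of_real nrm)^-1 = of_real nrm^-1 :> R[i].
    exact: (esym (fmorphV (real_complex R) nrm)).
  rewrite /c; move: ReD; case: (w^*%C * D) => x' y' /= ->.
  by apply/eqP; rewrite eq_complex /=; apply/andP; split; apply/eqP; ring.
have ncN : m%:R * z ^+ m.-1 * (- n) = of_real (- c) * w.
  by rewrite mulrN nc -mulNr; congr (_ * _); rewrite /of_real; simpc.
have c0 : c != 0.
  rewrite mulf_neq0 ?invr_eq0 ?(lt0r_neq0 nrm0)// oppr_eq0.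
  have : normsq (w^*%C * D) != 0.
    rewrite normsqM mulf_neq0 ?lt0r_neq0 ?normsq_gt0// conjc_eq0 -normsq_gt0.
    by rewrite w1.
  by rewrite /normsq ReD expr0n /= add0r sqrf_eq0.
have [d [dp dm]] := S _ (is_green_green hm h0 hpi clE) i z n Ii Gz un.
have e1 := cvg_unique (@norm_hausdorff _ _) dp (HL n c nc).
have e2 := cvg_unique (@norm_hausdorff _ _) dm (HL (- n) (- c) ncN).
have C0 : (2 * m%:R)^-1 != 0 :> R.
  by rewrite invr_eq0 mulf_neq0 ?pnatr_eq0 -?lt0n.
have LN : complex.Re (L * - n) = - complex.Re (L * n).
  by rewrite mulrN; case: (L * n).
have kV0 : k^-1 != 0 by rewrite invr_eq0 lt0r_neq0.
(* The corner term is even in [n], so it cancels and only the odd part [k c] is left. *)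
have {e2} : k * c = k * - c.
  apply: (@addIr _ `|complex.Re (L * n)|); apply: (mulIf kV0); apply: (mulfI C0).
  by rewrite -e1 e2 LN normrN.
rewrite mulrN => /eqP.
by rewrite -addr_eq0 -mulr2n mulrn_eq0 mulf_eq0 (gt_eqF k0) (negbTE c0).
Unshelve. all: by end_near. Qed.
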